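(* Let $k\ge 1$ and let $\lambda$ be a strict partition. Then $$RQ^{(k)}_\lambda(X)=\sum_{T'}F_{\mathrm{Des}(T')}(X)=\sum_{T}2^{|\mathrm{Peak}(\mathrm{Des}(T))|+1}\,G_{\mathrm{Peak}(\mathrm{Des}(T))}(X).$$ The first sum runs over all marked standard shifted $k$-ribbon tableaux $T'$ of shape $\lambda$. The second sum runs over all standard shifted $k$-ribbon tableaux $T$ of shape $\lambda$.
   Context: Conventions. Diagrams are drawn in French convention, with rows numbered from the bottom. A strict partition $\lambda=(\lambda_1>\cdots>\lambda_\ell>0)$ is identified with its shifted diagram $\{(c,r):1\le r\le\ell,\ r\le c\le r+\lambda_r-1\}$. The diagonal value of a cell is $c-r+1$, and the main diagonal consists of the cells of value $1$. A subset $R\subseteq\lambda$ is removable if $\lambda\setminus R$ is a shifted diagram. Ribbons. A single ribbon is a nonempty edge-connected skew-shifted diagram with cells on distinct diagonals. Its head $H(R)$ and tail $T(R)$ are its cells of largest and smallest diagonal value. A double ribbon in $\lambda$ is a union $R\cup S$ of disjoint single ribbons with $|R|\ge|S|$ such that $T(R)$ is on the main diagonal of $\lambda$, $T(S)$ is on the main diagonal of $\lambda\setminus R$, and $R\cup S$ is skew-shifted. Its head is $H(R)$. A $k$-ribbon is a single or double ribbon with $k$ cells. A $k$-core is a shifted diagram with no removable $k$-ribbon. Standard tableaux. A standard shifted $k$-ribbon tableau of shape $\lambda$ is a chain $\lambda^{(0)}\subset\cdots\subset\lambda^{(n)}=\lambda$ such that $\lambda^{(0)}$ is a $k$-core and each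 $\lambda^{(i)}\setminus\lambda^{(i-1)}$ is a removable $k$-ribbon of $\lambda^{(i)}$, labelled $i$. Its reading word lists the labels of the heads of the ribbons row by row, from the top row to the bottom row, and from left to right within a row. $\mathrm{Des}(T)=\{i\in[n-1]: i+1 \text{ appears to the left of } i \text{ in the reading word}\}$. Marked standard tableaux. A marked standard shifted $k$-ribbon tableau $T'$ is a standard one $T$ together with a subset $M\subseteq[n]$, where the label $i$ is replaced by $i'$ for $i\in M$; the set of these is $\mathrm{Mark}(T)$. To define $\mathrm{Des}(T')$, form the word consisting of the marked labels in the reverse of their order in the reading word, followed by the unmarked labels in their order in the reading word, all marks being erased. Then $\mathrm{Des}(T')$ is the set of $i\in[n-1]$ such that $i+1$ appears to the left of $i$ in this word. Semi-standard tableaux. Horizontal (resp. vertical) $k$-ribbon strips $\lambda\setminus\lambda^{(0)}$ are given by chains $\lambda^{(0)}\subset\cdots\subset\lambda^{(t)}=\lambda$ of removable $k$-ribbon additions $R_i$ with $H(R_i)$ in a column strictly right of (resp. a row strictly above) $H(R_{i-1})$. A semi-standard shifted $k$-ribbon tableau is a chain $\lambda^{(0)}\subseteq\lambda^{(1')}\subseteq\lambda^{(1)}\subseteq\cdots\subseteq\lambda^{(m)}=\lambda$, with strip decompositions, such that: - $\lambda^{(0)}$ is a $k$-core; - $\lambda^{(i')}\setminus\lambda^{(i-1)}$ is a vertical strip, whose ribbons are labelled $i'$; - $\lambda^{(i)}\setminus\lambda^{(i')}$ is a horizontal strip, whose ribbons are labelled $i$. Then $RQ^{(k)}_\lambda(X)=\sum_S\prod_i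 x_i^{\#\{\text{ribbons labelled } i \text{ or } i'\}}$. Quasisymmetric functions. For $D\subseteq[n-1]$, $F_D(X)=\sum x_{i_1}\cdots x_{i_n}$, summed over $i_1\le\cdots\le i_n$ with $i_t<i_{t+1}$ whenever $t\in D$. Further: - $\mathrm{Peak}(D)=\{i\ge2: i\in D,\ i-1\notin D\}$; - $\mathrm{Spike}(D)=\{i\ge 2: \text{exactly one of } i,\ i-1 \text{ lies in } D\}$; - for such a set $P$, $G_P(X)=\sum_{D\subseteq[n-1],\ \mathrm{Spike}(D)\supseteq P}F_D(X)$.
   Formalization: The second equality is stated only for λ that is not a k-core: if λ is a k-core, the only tableau has n = 0, so RQ = 1 while the last sum equals 2. The first equality is stated for every strict partition. *)

(* Defs.v *)
From mathcomp Require Import all_boot all_order all_algebra.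
From mathcomp Require Import finmap multiset.
From mathcomp Require Import boolp classical_sets functions cardinality fsbigop.

Set Implicit Arguments.
Unset Strict Implicit.
Unset Printing Implicit Defensive.

Import GRing.Theory.

Local Open Scope classical_set_scope.
Local Open Scope fset_scope.
Local Open Scope nat_scope.

(* Cells are pairs (column, row), both counted from 1, rows from the bottom. *)
Notation cell := (nat * nat)%type.
Notation shape := (seq nat).

Definition strict_partition (la : shape) : bool :=
  sorted gtn la && (0 \notin la).

(* la_r is [nth 0 la r.-1], and [iota r la_r] lists r, ..., r + la_r - 1. *)
Definition diagram (la : shape) : {fset cell} :=
  [fset x in [seq (c, r) | r <- iota 1 (size la), c <- iota r (nth 0 la r.-1)]].

(* Subtraction on nat is truncated, but c >= r for every cell (c, r) of a
   shifted diagram. *)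
Definition diag (x : cell) : nat := x.1 - x.2 + 1.

Definition main_diagonal (A : {fset cell}) : {fset cell} :=
  [fset x in A | diag x == 1].

Definition shifted_diagram (A : {fset cell}) : Prop :=
  exists mu, strict_partition mu /\ A = diagram mu.

Definition skew_shifted (A : {fset cell}) : Prop :=
  exists la mu, [/\ strict_partition la, strict_partition mu,
    diagram mu `<=` diagram la & A = diagram la `\` diagram mu].

Definition removable (la : shape) (A : {fset cell}) : Prop :=
  A `<=` diagram la /\ shifted_diagram (diagram la `\` A).

Definition share_edge : rel cell := fun x y =>
  [|| (x.1 == y.1) && (x.2 == y.2.+1), (x.1 == y.1) && (y.2 == x.2.+1),
      (x.2 == y.2) && (x.1 == y.1.+1) | (x.2 == y.2) && (y.1 == x.1.+1)].

Definition edge_connected (A : {fset cell}) : Prop :=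
  forall x y, x \in A -> y \in A ->
  exists p, [/\ path share_edge x p, {subset p <= A} & last x p = y].

Definition single_ribbon (R : {fset cell}) : Prop :=
  [/\ R != fset0, skew_shifted R, edge_connected R & {in R &, injective diag}].

Definition ribbon_head (R : {fset cell}) : cell :=
  xget (0, 0) [set x | x \in R /\ forall y, y \in R -> diag y <= diag x].

Definition ribbon_tail (R : {fset cell}) : cell :=
  xget (0, 0) [set x | x \in R /\ forall y, y \in R -> diag x <= diag y].

Definition double_ribbon (la : shape) (R S : {fset cell}) : Prop :=
  [/\ [/\ single_ribbon R, single_ribbon S, [disjoint R & S] &
          R `|` S `<=` diagram la],
      #|` S| <= #|` R|,
      ribbon_tail R \in main_diagonal (diagram la),
      ribbon_tail S \in main_diagonal (diagram la `\` R) &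
      skew_shifted (R `|` S)].

Definition k_ribbon (k : nat) (la : shape) (Q : {fset cell}) : Prop :=
  #|` Q| = k /\
  (single_ribbon Q \/ exists R S, double_ribbon la R S /\ Q = R `|` S).

(* Head of a single or double ribbon Q in la. *)
Definition head_in (la : shape) (Q : {fset cell}) : cell :=
  xget (0, 0) [set h | (single_ribbon Q /\ h = ribbon_head Q) \/
    exists R S, [/\ double_ribbon la R S, Q = R `|` S & h = ribbon_head R]].

Definition k_core (k : nat) (la : shape) : Prop :=
  strict_partition la /\ ~ exists Q, removable la Q /\ k_ribbon k la Q.

(* nu arises from mu by adding a k-ribbon that is removable in nu. *)
Definition ribbon_step (k : nat) (mu nu : shape) : Prop :=
  [/\ strict_partition mu, strict_partition nu, diagram mu `<=` diagram nu,
      removable nu (diagram nu `\` diagram mu) &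
      k_ribbon k nu (diagram nu `\` diagram mu)].

(* A chain mu_0, ..., mu_t is given by mu = mu_0 and c = [:: mu_1; ...; mu_t]. *)
Definition ribbon_chain (k : nat) (mu : shape) (c : seq shape) : bool :=
  path (fun mu nu => `[< ribbon_step k mu nu >]) mu c.

(* Heads of the successively added ribbons. *)
Definition heads (mu : shape) (c : seq shape) : seq cell :=
  pairmap (fun mu nu => head_in nu (diagram nu `\` diagram mu)) mu c.

(* The chain (T.1, T.2) consists of lambda^(0), ..., lambda^(n), and
   n = size T.2. *)
Notation tableau := (shape * seq shape)%type.

Definition standard_tableaux (k : nat) (la : shape) : set tableau :=
  [set T | [/\ k_core k T.1, ribbon_chain k T.1 T.2 & last T.1 T.2 = la]].

(* The head of the ribbon labelled i, for 1 <= i <= n. *)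
Definition label_head (T : tableau) (i : nat) : cell :=
  nth (0, 0) (heads T.1 T.2) i.-1.

(* Top row first, then left to right. *)
Definition reading_le : rel cell := fun x y =>
  (y.2 < x.2) || ((x.2 == y.2) && (x.1 <= y.1)).

Definition reading_word (T : tableau) : seq nat :=
  sort (fun i j => reading_le (label_head T i) (label_head T j))
    (iota 1 (size T.2)).

(* [index i w] is the position of the letter i in w. *)
Definition word_des (w : seq nat) : {fset nat} :=
  [fset i in iota 1 (size w).-1 | index i.+1 w < index i w].

Definition Des (T : tableau) : {fset nat} := word_des (reading_word T).

(* A marked tableau is a pair (T, M). *)
Definition marked_tableaux (k : nat) (la : shape) :
    set (tableau * {fset nat}) :=
  [set T' | standard_tableaux k la T'.1 /\
    T'.2 `<=` [fset i in iota 1 (size T'.1.2)]].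

Definition marked_word (T' : tableau * {fset nat}) : seq nat :=
  rev [seq i <- reading_word T'.1 | i \in T'.2] ++
  [seq i <- reading_word T'.1 | i \notin T'.2].

Definition Des_marked (T' : tableau * {fset nat}) : {fset nat} :=
  word_des (marked_word T').

Definition horizontal_strip (k : nat) (mu : shape) (c : seq shape) : Prop :=
  ribbon_chain k mu c /\ sorted (fun x y : cell => x.1 < y.1) (heads mu c).

Definition vertical_strip (k : nat) (mu : shape) (c : seq shape) : Prop :=
  ribbon_chain k mu c /\ sorted (fun x y : cell => x.2 < y.2) (heads mu c).

(* The i-th entry (v, h) of s holds the chain v from lambda^(i-1) to
   lambda^(i') and the chain h from lambda^(i') to lambda^(i). *)
Fixpoint strip_chain (k : nat) (mu : shape) (s : seq (seq shape * seq shape))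
    (la : shape) : Prop :=
  if s is (v, h) :: s' then
    [/\ vertical_strip k mu v, horizontal_strip k (last mu v) h &
        strip_chain k (last (last mu v) h) s' la]
  else mu = la.

Notation ss_tableau := (shape * seq (seq shape * seq shape))%type.

(* The number m of pairs of strips is not fixed; appending empty strips does
   not change the labelled ribbons, so only the shortest chain is kept: the
   last two strips are not both empty. *)
Definition semistandard_tableaux (k : nat) (la : shape) : set ss_tableau :=
  [set S | [/\ k_core k S.1, strip_chain k S.1 S.2 la &
    forall s, S.2 <> rcons s ([::], [::])]].

(* Formal power series in x_1, x_2, ... with integer coefficients. The monomial
   x_{i_1} ... x_{i_n} is the multiset of its indices, and a series is its
   coefficient function; addition is pointwise. *)
Notation monomial := {mset nat}%mset.
Notation series := (monomial -> int).

(* The sum of the monomials wt x over x in A. The sums over (_ \in _) are those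
   of fsbigop, hence 0 on infinite supports: this requires that only finitely
   many x in A have any given weight. *)
Definition monomial_sum (X : choiceType) (A : set X) (wt : X -> monomial) :
    series :=
  fun alpha => (\sum_(x \in A) ((wt x == alpha)%:R : int))%R.

(* Label i or i' is carried by size v + size h ribbons, where (v, h) is the
   i-th entry of S.2. *)
Definition ss_weight (S : ss_tableau) : monomial :=
  seq_mset (flatten [seq nseq (size (nth ([::], [::]) S.2 i.-1).1 +
                               size (nth ([::], [::]) S.2 i.-1).2) i
                    | i <- iota 1 (size S.2)]).

Definition RQ (k : nat) (la : shape) : series :=
  monomial_sum (semistandard_tableaux k la) ss_weight.

(* The summation index is s = [:: i_1; ...; i_n], so i_t is [nth 0 s t.-1]. *)
Definition F (n : nat) (D : {fset nat}) : series :=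
  monomial_sum
    [set s : seq nat | [/\ size s = n, all (leq 1) s, sorted leq s &
       forall t, t \in D -> nth 0 s t.-1 < nth 0 s t]]
    (fun s => seq_mset s).

Definition Peak (D : {fset nat}) : {fset nat} :=
  [fset i in D | (2 <= i) && (i.-1 \notin D)].

(* If exactly one of i, i - 1 is in D, then i lies in D or in D + 1. *)
Definition Spike (D : {fset nat}) : {fset nat} :=
  [fset i in D `|` [fset j.+1 | j in D] |
    (2 <= i) && ((i \in D) (+) (i.-1 \in D))].

Definition G (n : nat) (P : {fset nat}) : series :=
  (\sum_(D <- fpowerset [fset i in iota 1 n.-1] | P `<=` Spike D) F n D)%R.

(* Main.v *)
Require Import Defs.
From mathcomp Require Import all_boot all_order all_algebra.
From mathcomp Require Import finmap multiset.
From mathcomp Require Import boolp classical_sets functions cardinality fsbigop.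
From mathcomp Require Import zify.

(* Let h and h' be the heads of two ribbons added one after the other. A head
   ends its row and has the largest diagonal value of its ribbon, so either h'
   is strictly to the right of h and weakly below it, or h' is strictly above h
   and weakly to its left; the second case is the one of a descent. Hence a
   sequence of labels, weakly increasing and compatible with the descents of a
   marked standard tableau, turns it into a semi-standard tableau, and this is a
   bijection, which gives the first equality. For the second, let D = Des(T).
   If i is in D then i is in Des(T') iff i is unmarked, and otherwise iff i + 1
   is marked. So the T' over T with Des(T') = E are the solutions of n - 1
   equations, each of which fixes one mark: the labels fixed twice are the
   peaks of D, where the two equations agree iff the peak is a spike of E, and
   |Peak(D)| + 1 labels are left free. *)

Set Implicit Arguments.
Unset Strict Implicit.
Unset Printing Implicit Defensive.

Local Open Scope classical_set_scope.
Local Open Scope fset_scope.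
Local Open Scope nat_scope.

(** * Shifted diagrams and diagonal values *)

Lemma mem_diagram (mu : seq nat) c r :
  ((c, r) \in diagram mu) =
  [&& 0 < r, r <= size mu, r <= c & c < r + nth 0 mu r.-1].
Proof.
rewrite !inE; apply/allpairsPdep/idP => [[r' [c' []]]|].
  by rewrite !mem_iota => + + [-> ->]; lia.
by move=> /and4P[*]; exists r, c; split; rewrite ?mem_iota //; lia.
Qed.

(** As the parts strictly decrease, the right end r + mu_r weakly decreases in r: a higher row never
    reaches further right. *)
Lemma diagram_down (mu : seq nat) c r c' r' : strict_partition mu ->
  (c, r) \in diagram mu -> 0 < r' -> r' <= r -> r' <= c' -> c' <= c ->
  (c', r') \in diagram mu.
Proof.
case/andP=> mu_sorted _; rewrite !mem_diagram => /and4P[r_gt0 r_le rc cr].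
move=> r'_gt0 r'r r'c' c'c; apply/and4P; split=> //; first exact: leq_trans r_le.
suff: r + nth 0 mu r.-1 <= r' + nth 0 mu r'.-1 by lia.
elim: r r'r r_gt0 r_le {rc cr} => [|r IHr]; first by lia.
rewrite leq_eqVlt => /predU1P[-> //|r'r] _ r_le; rewrite ltnS in r'r.
apply: leq_trans (IHr r'r _ _); [|lia|lia].
have gtn_tr : transitive gtn by move=> y x z /=; lia.
have := sorted_ltn_nth gtn_tr 0 mu_sorted; rewrite /= => sorted_mu.
suff: nth 0 mu r < nth 0 mu r.-1 by lia.
by apply: (sorted_mu r.-1 r); rewrite ?inE; lia.
Qed.

(** An edge changes the diagonal value by exactly one, so no value is skipped; [z.2 <= z.1] keeps
    the truncated subtraction in [diag] exact. *)
Lemma diag_path x p y : path share_edge x p -> last x p = y ->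
  (forall z, z \in x :: p -> z.2 <= z.1) ->
  forall d, diag x <= d <= diag y -> exists2 z, z \in x :: p & diag z = d.
Proof.
elim: p x => [|z p IHp] x /=.
  by move=> _ <- _ d dP; exists x; rewrite ?mem_head //; lia.
case/andP=> xz zp zpy le21 d /andP[xd dy].
have [<-|xd'] := eqVneq (diag x) d; first by exists x; rewrite ?mem_head.
have [||w wp <-] := IHp z zp zpy _ d.
- by move=> w wp; apply: le21; rewrite inE wp orbT.
- move: xz xd xd' dy (le21 x) (le21 z).
  rewrite !inE !eqxx orbT => + + + + /(_ isT) + /(_ isT).
  by rewrite /diag /share_edge; lia.
- by exists w; rewrite // inE wp orbT.
Qed.

Lemma diag_interval (S : {fset nat * nat}) x y : edge_connected S ->
  (forall z, z \in S -> z.2 <= z.1) -> x \in S -> y \in S ->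
  forall d, diag x <= d <= diag y -> exists2 z, z \in S & diag z = d.
Proof.
move=> S_conn le21 xS yS d dP; have [p [xp pS lp]] := S_conn x y xS yS.
have sub z : z \in x :: p -> z \in S by rewrite inE => /predU1P[->|/pS].
have [z /sub zS <-] := diag_path xp lp (fun z zp => le21 z (sub z zp)) dP.
by exists z.
Qed.

(** * Heads and tails of ribbons *)

Lemma ribbon_headP R : R != fset0 ->
  ribbon_head R \in R /\ forall y, y \in R -> diag y <= diag (ribbon_head R).
Proof.
case/fset0Pn=> x0 x0R; rewrite /ribbon_head; set P := (X in xget _ X).
suff [x Px] : exists x, P x by have := xgetI (0, 0) Px.
have [i _ max_i] := @arg_maxnP R [` x0R] xpredT (fun z => diag (val z)) isT.
exists (val i); split=> [|y yR]; first exact: valP.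
exact: (max_i [` yR]).
Qed.

Lemma ribbon_tailP R : R != fset0 ->
  ribbon_tail R \in R /\ forall y, y \in R -> diag (ribbon_tail R) <= diag y.
Proof.
case/fset0Pn=> x0 x0R; rewrite /ribbon_tail; set P := (X in xget _ X).
suff [x Px] : exists x, P x by have := xgetI (0, 0) Px.
have [i _ min_i] := @arg_minnP R [` x0R] xpredT (fun z => diag (val z)) isT.
exists (val i); split=> [|y yR]; first exact: valP.
exact: (min_i [` yR]).
Qed.

(** The diagonal values of a ribbon are distinct, at least 1 and at most that of its head. *)
Lemma card_ribbon_le R : single_ribbon R -> #|` R| <= diag (ribbon_head R).
Proof.
case=> R0 _ _ inj; have [_ max_h] := ribbon_headP R0.
rewrite -(size_map diag) -[leqRHS](size_iota 1).
apply: uniq_leq_size; first by rewrite map_inj_in_uniq ?fset_uniq.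
by move=> d /mapP[y /max_h y_le ->]; rewrite mem_iota; move: y_le; rewrite /diag; lia.
Qed.

(** By connectedness, a ribbon that starts on the main diagonal meets every diagonal up to its
    head. *)
Lemma diag_head_le R : single_ribbon R -> (forall z, z \in R -> z.2 <= z.1) ->
  diag (ribbon_tail R) = 1 -> diag (ribbon_head R) <= #|` R|.
Proof.
case=> R0 _ conn inj le21 tail1.
have [hR max_h] := ribbon_headP R0; have [tR _] := ribbon_tailP R0.
rewrite -[leqLHS](size_iota 1) -(size_map diag R).
apply: uniq_leq_size (iota_uniq _ _) _ => d; rewrite mem_iota => d_in.
have [|z zR <-] := diag_interval conn le21 tR hR (d := d); first by lia.
exact: map_f.
Qed.

(** In a double ribbon S starts on the main diagonal, so diag H(S) <= |S| <= |R| <= diag H(R). Thus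
    H(R) is maximal on R and S together, whichever decomposition [xget] picks. *)
Lemma head_in_max k la Q : Q `<=` diagram la -> k_ribbon k la Q ->
  head_in la Q \in Q /\ forall y, y \in Q -> diag y <= diag (head_in la Q).
Proof.
move=> Qla [_ Q_ribbon]; rewrite /head_in; set P := (X in xget _ X).
have [h Ph] : exists h, P h.
  case: Q_ribbon => [Qs|[R [S [dRS eQ]]]]; first by exists (ribbon_head Q); left.
  by exists (ribbon_head R); right; exists R, S.
case: (xgetI (0, 0) Ph) => [[Qs ->]|]; first by apply: ribbon_headP; case: Qs.
case=> R [S [[[Rs Ss _ RSla] leSR _ tS _] eQ ->]].
have [hR max_R] : _ /\ _ := ribbon_headP (let: And4 R0 _ _ _ := Rs in R0).
have [_ max_S] : _ /\ _ := ribbon_headP (let: And4 S0 _ _ _ := Ss in S0).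
rewrite eQ; split=> [|y]; rewrite !inE ?hR // => /orP[/max_R//|/max_S yS].
apply: leq_trans yS _; apply: leq_trans (card_ribbon_le Rs).
apply: leq_trans leSR; apply: diag_head_le => //.
  move=> [c r] zS; have: (c, r) \in diagram la.
    by apply: (fsubsetP RSla); rewrite inE zS orbT.
  by rewrite mem_diagram => /and4P[].
by move: tS; rewrite !inE => /andP[_ /eqP].
Qed.

Definition step_head (mu nu : seq nat) : nat * nat :=
  head_in nu (diagram nu `\` diagram mu).

Lemma step_headP k mu nu : ribbon_step k mu nu ->
  [/\ step_head mu nu \in diagram nu, step_head mu nu \notin diagram mu &
  forall y, y \in diagram nu -> y \notin diagram mu ->
    diag y <= diag (step_head mu nu)].
Proof.
case=> _ _ _ _ /(head_in_max (fsubsetDl _ _))[].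
rewrite -/(step_head mu nu) inE => /andP[-> ->] max_h; split=> // y ynu ymu.
by apply: max_h; rewrite inE ymu.
Qed.

(* The head of a removable ribbon ends its row; a head to the north-east of
   the previous one would leave a cell of larger diagonal value below it. *)
Lemma consecutive_heads k la mu nu (h := step_head la mu)
    (h' := step_head mu nu) : ribbon_step k la mu -> ribbon_step k mu nu ->
  (h.1 < h'.1) && (h'.2 <= h.2) || (h'.1 <= h.1) && (h.2 < h'.2).
Proof.
move=> s1 s2; have [h_mu h_la max_h] := step_headP s1.
have [h'_nu h'_mu max_h'] := step_headP s2.
rewrite -/h -/h' in h_mu h_la max_h h'_nu h'_mu max_h'.
case: s1 s2 => la_strict mu_strict la_mu _ _ [_ nu_strict mu_nu _ _].
clearbody h h'; case: h h' => [c r] [c' r'] /= in h_mu h_la max_h h'_nu h'_mu max_h' *.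
have := h_mu; have := h'_nu; rewrite !mem_diagram.
move=> /and4P[r'_gt0 _ r'c' _] /and4P[r_gt0 _ rc _].
have row_end : (c.+1, r) \notin diagram mu.
  apply/negP => c1_mu; case: (boolP ((c.+1, r) \in diagram la)).
  - by move/diagram_down => /(_ c r la_strict) c1_la; case/negP: h_la; apply: c1_la; lia.
  - by move=> c1_la; have := max_h _ c1_mu c1_la; rewrite /diag /=; lia.
case: (ltnP c c') => cc' /=.
  rewrite orbF leqNgt; apply/negP => rr'.
  have c'r_nu : (c', r) \in diagram nu by apply: diagram_down h'_nu _ _ _ _; lia.
  have c'r_mu : (c', r) \notin diagram mu.
    by apply: contra row_end => /diagram_down; apply=> //; lia.
  by have := max_h' _ c'r_nu c'r_mu; rewrite /diag /=; lia.
rewrite ltnNge; apply: contra h'_mu => r'r.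
by apply: diagram_down h_mu _ _ _ _.
Qed.

(** * Descent sets of standard and marked tableaux *)

(** Subsequences pass through filtering and reversal, positions do not; this is how descents of the
    marked word are compared with those of the reading word. *)
Lemma index_subseq (T : eqType) (x y : T) s : uniq s -> x != y -> y \in s ->
  (index x s < index y s) = subseq [:: x; y] s.
Proof.
elim: s => // a s IHs /andP[a_s uniq_s] xy; rewrite inE /=.
rewrite ![a == _]eq_sym.
have [ya _|ya /= ys] := eqVneq y a.
  rewrite -ya (negPf xy) /=; apply/esym/negbTE; rewrite ya.
  by apply: contra a_s => /mem_subseq; apply; rewrite !inE eqxx orbT.
have [_|xa] := eqVneq x a; first by rewrite sub1seq ys.
by rewrite ltnS IHs.
Qed.

Lemma mem_word_des w i :
  (i \in word_des w) = (0 < i < size w) && (index i.+1 w < index i w).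
Proof. by rewrite !inE mem_iota; congr (_ && _); lia. Qed.

Lemma reading_le_total : total reading_le.
Proof. by move=> [a b] [c d]; rewrite /reading_le /=; lia. Qed.

Lemma reading_le_trans : transitive reading_le.
Proof. by move=> [a b] [c d] [e f]; rewrite /reading_le /=; lia. Qed.

Lemma perm_reading_word T : perm_eq (reading_word T) (iota 1 (size T.2)).
Proof. by rewrite perm_sort. Qed.

Lemma uniq_reading_word T : uniq (reading_word T).
Proof. by rewrite (perm_uniq (perm_reading_word T)) iota_uniq. Qed.

Lemma size_reading_word T : size (reading_word T) = size T.2.
Proof. by rewrite size_sort size_iota. Qed.

Lemma mem_reading_word T i : (i \in reading_word T) = (0 < i <= size T.2).
Proof. by rewrite mem_sort mem_iota; lia. Qed.

Lemma label_headE T i : i < size T.2 ->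
  label_head T i.+1 = step_head (nth [::] (T.1 :: T.2) i) (nth [::] T.2 i).
Proof. by move=> i_lt; rewrite /label_head /heads (nth_pairmap [::]). Qed.

Lemma label_head_consecutive k T i (h := label_head T i)
    (h' := label_head T i.+1) : ribbon_chain k T.1 T.2 -> 0 < i < size T.2 ->
  (h.1 < h'.1) && (h'.2 <= h.2) || (h'.1 <= h.1) && (h.2 < h'.2).
Proof.
case: i @h @h' => // i h h' /pathP chain /= i_lt.
rewrite /h /h' !label_headE //; last by lia.
apply: (@consecutive_heads k).
  by apply/asboolP; apply: chain; lia.
by have := chain [::] i.+1 i_lt; move/asboolP.
Qed.

(** A descent needs the head of i + 1 in a higher row or further left in the same row; the dichotomy
    for consecutive heads excludes the latter. *)
Lemma mem_Des k T i : ribbon_chain k T.1 T.2 ->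
  (i \in Des T) =
  (0 < i < size T.2) && ((label_head T i).2 < (label_head T i.+1).2).
Proof.
move=> chain; rewrite mem_word_des size_reading_word.
case: (boolP (0 < i < size T.2)) => //= i_in.
have := label_head_consecutive chain i_in.
set w := reading_word T; have iw : i \in w by rewrite mem_reading_word; lia.
have i1w : i.+1 \in w by rewrite mem_reading_word; lia.
set le := fun i j => reading_le (label_head T i) (label_head T j).
have le_tr : transitive le by move=> a b c; apply: reading_le_trans.
have w_sorted : sorted le w by apply: sort_sorted => a b; apply: reading_le_total.
have := sorted_ltn_index le_tr w_sorted _ _ i1w iw.
have := sorted_ltn_index le_tr w_sorted _ _ iw i1w.
have : index i w != index i.+1 w.
  by apply/eqP => e; have := nth_index 0 iw; rewrite e nth_index //; lia.
rewrite /le /reading_le; case: ltngtP => // _ _.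
  by move=> /(_ isT) + _; lia.
by move=> _ /(_ isT); lia.
Qed.

Lemma subset_Des T : Des T `<=` [fset i in iota 1 (size T.2).-1].
Proof.
apply/fsubsetP => i; rewrite mem_word_des size_reading_word !inE mem_iota; lia.
Qed.

Lemma perm_marked_word T' :
  perm_eq (marked_word T') (reading_word T'.1).
Proof.
by rewrite /marked_word perm_sym -(perm_filterC (mem T'.2)) perm_cat2r perm_sym
  perm_rev.
Qed.

(** Marked letters precede unmarked ones, so a single mark among i and i + 1 decides; two marks
    reverse the order of the reading word, none keeps it. *)
Lemma mem_Des_marked T M i : (i \in Des_marked (T, M)) =
  (0 < i < size T.2) && (if i \in Des T then i \notin M else i.+1 \in M).
Proof.
rewrite !mem_word_des (perm_size (perm_marked_word _)) size_reading_word.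
case: (boolP (0 < i < size T.2)) => //= i_in.
set w := reading_word T; have iw : i \in w by rewrite mem_reading_word; lia.
have i1w : i.+1 \in w by rewrite mem_reading_word; lia.
have uw : uniq w := uniq_reading_word T.
have n_i : i.+1 != i by lia.
have nw : (index i w < index i.+1 w) = ~~ (index i.+1 w < index i w).
  have : index i w != index i.+1 w.
    by apply/eqP => e; have := nth_index 0 iw; rewrite e nth_index //; lia.
  by case: ltngtP.
rewrite /marked_word !index_cat !mem_rev !mem_filter /= -/w iw i1w !andbT.
set A := filter _ w; set B := filter _ w.
have uA : uniq A by apply: filter_uniq.
have uB : uniq B by apply: filter_uniq.
have inA j : j \in w -> j \in M -> j \in A by move=> jw jM; rewrite mem_filter jM.
have inB j : j \in w -> j \notin M -> j \in B by move=> jw jM; rewrite mem_filter jM.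
have idx j : j \in A -> index j (rev A) < size (rev A) by move=> jA; rewrite index_mem mem_rev.
case: (boolP (i \in M)) => iM; case: (boolP (i.+1 \in M)) => i1M.
- rewrite index_subseq ?rev_uniq ?mem_rev ?inA //.
  (* i + 1 before i in [rev A] means i before i + 1 in [A]. *)
  rewrite -[[:: _; _]]revK subseq_rev subseq_filter /= iM i1M /=.
  by rewrite -index_subseq // 1?eq_sym // nw; case: ifP.
- rewrite if_same; apply/negbTE; rewrite -leqNgt.
  exact: leq_trans (ltnW (idx i (inA i iw iM))) (leq_addr _ _).
- by rewrite if_same ltn_addr // (idx i.+1 (inA i.+1 i1w i1M)).
- rewrite ltn_add2l index_subseq ?inB // subseq_filter /= iM i1M /=.
  by rewrite -index_subseq //; case: ifP.
Qed.

(** * Semi-standard tableaux as sequences of labelled entries *)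

(* The entry (j, b, x) is the item x labelled j' if b and j otherwise; the first
   pair of p has label i. *)
Fixpoint entries (A : Type) (i : nat) (p : seq (seq A * seq A)) :
    seq (nat * bool * A) :=
  if p is (v, h) :: p' then
    map (pair (i, true)) v ++ map (pair (i, false)) h ++ entries i.+1 p'
  else [::].

(** The weak form of the order 1' < 1 < 2' < 2 < ... on labels. *)
Definition label_le : rel (nat * bool) := fun x y =>
  (x.1 < y.1) || (x.1 == y.1) && (y.2 ==> x.2).

(** Refines [label_le]: ribbons with equal labels form a vertical strip when marked and a horizontal
    strip when unmarked. Being transitive, it may be tested on neighbours only. *)
Definition strip_lt : rel (nat * bool * (nat * nat)) := fun x y =>
  (x.1.1 < y.1.1) || (x.1.1 == y.1.1) &&
  (if x.1.2 then y.1.2 ==> (x.2.2 < y.2.2) else ~~ y.1.2 && (x.2.1 < y.2.1)).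

Lemma label_le_trans : transitive label_le.
Proof. by move=> [j c] [i b] [k d]; rewrite /label_le /=; case: b c d => [] [] []; lia. Qed.

Lemma strip_lt_trans : transitive strip_lt.
Proof.
move=> [[j c] [? ?]] [[i b] [? ?]] [[k d] [? ?]]; rewrite /strip_lt /=.
by case: b c d => [] [] []; lia.
Qed.

Lemma entries_cat (A : Type) i (p q : seq (seq A * seq A)) :
  entries i (p ++ q) = entries i p ++ entries (i + size p) q.
Proof.
elim: p i => [|[v h] p IHp] i /=; first by rewrite addn0.
by rewrite IHp -!catA addnS addSn.
Qed.

Lemma entries_nseq (A : Type) i n (p : seq (seq A * seq A)) :
  entries i (nseq n ([::], [::]) ++ p) = entries (i + n) p.
Proof.
by elim: n i => [|n IHn] i /=; rewrite ?addn0 // IHn addSnnS.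
Qed.

Lemma entries_label (A : Type) i (p : seq (seq A * seq A)) :
  all (fun x => i <= x.1.1) (entries i p).
Proof.
have label_i j b s : all (fun x => j <= x.1.1) (map (@pair _ A (j, b)) s).
  by elim: s => //= x s ->; rewrite leqnn.
elim: p i => [|[v h] p IHp] i //=; rewrite !all_cat !label_i /=.
by apply: (sub_all _ (IHp i.+1)) => x; apply: ltnW.
Qed.

(** Trailing pairs of empty strips leave no trace in [entries]; this is the condition that selects
    the shortest chain in [semistandard_tableaux]. *)
Definition no_empty_tail (A : eqType) (p : seq (seq A * seq A)) : Prop :=
  forall s, p <> rcons s ([::], [::]).

(** Filtering by label recovers each strip. Empty pairs before the last entry show in the labels,
    and there are none after it. *)
Lemma entries_inj (A : eqType) i (p q : seq (seq A * seq A)) :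
  no_empty_tail p -> no_empty_tail q -> entries i p = entries i q -> p = q.
Proof.
have nil_entries j r : no_empty_tail r -> [::] = @entries A j r -> r = [::].
  case/lastP: r => // r [v h] net; rewrite -cats1 entries_cat /= cats0.
  case: v h net => [|x v] [|y h] net; do ?by move=> /(congr1 size); rewrite !size_cat /= ?addnS.
  by have /(_ erefl) := net r.
elim: p q i => [|[v h] p IHp] [|[v' h'] q] i net_p net_q //.
- by move=> /nil_entries ->.
- by move=> /esym/nil_entries ->.
have filter_pair (Q : pred (nat * bool)) y (s : seq A) :
    filter (preim fst Q) (map (pair y) s) =
    if Q y then map (pair y) s else [::].
  by elim: s => [|x s /= ->] /=; case: (Q y).
have filter_low b r : [seq x <- @entries A i.+1 r | x.1 == (i, b)] = [::].
  apply/eqP; rewrite -size_eq0 size_filter -leqn0 leqNgt -has_count -all_predC.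
  by apply: (sub_all _ (entries_label i.+1 r)) => -[[j c] x] /= ij; rewrite xpair_eqE; lia.
have filter_high r : [seq x <- @entries A i.+1 r | i < x.1.1] = entries i.+1 r.
  exact/all_filterP/entries_label.
have pair_inj y : injective (map (@pair (nat * bool) A y)) by apply: inj_map => ? ? [].
move=> /= eq_pq; congr ((_, _) :: _).
- have := congr1 ((filter (preim fst (pred1 (i, true))))) eq_pq.
  rewrite !filter_cat !filter_pair !filter_low /= !xpair_eqE /= eqxx /= !cats0; apply: pair_inj.
- have := congr1 ((filter (preim fst (pred1 (i, false))))) eq_pq.
  rewrite !filter_cat !filter_pair !filter_low /= !xpair_eqE /= eqxx /= !cats0; apply: pair_inj.
- apply: (IHp q i.+1).
  + by move=> s es; have := net_p ((v, h) :: s); rewrite es => /(_ erefl).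
  + by move=> s es; have := net_q ((v', h') :: s); rewrite es => /(_ erefl).
  + have := congr1 ((filter (preim fst (fun y => i < y.1)))) eq_pq.
    by rewrite !filter_cat !filter_pair /= ltnn /= !filter_high.
Qed.

(** By induction, the first entry is put in front of its strip, and empty pairs are inserted before
    it until the label reaches j. *)
Lemma entries_surj (A : eqType) i (z : seq (nat * bool * A)) :
  sorted label_le (map fst z) -> all (fun x => i <= x.1.1) z ->
  exists2 p, no_empty_tail p & entries i p = z.
Proof.
elim: z i => [|[[j b] x] z IHz] i /=; first by exists [::] => // -[].
rewrite (path_sortedE label_le_trans) => /andP[/allP le_z sorted_z] /andP[ij _].
(* The padding is harmless because [p] is nonempty: its last pair stays last. *)
suff [p net_p [nz_p <-]] : exists2 p, no_empty_tail p &
    p != [::] /\ entries j p = (j, b, x) :: z.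
  exists (nseq (j - i) ([::], [::]) ++ p); last by rewrite entries_nseq subnKC.
  move=> s; case/lastP: p net_p nz_p => // p y net_p _.
  by rewrite -rcons_cat => /rcons_inj[_ ey]; have := net_p p; rewrite ey => /(_ erefl).
have [|p net_p ep] := IHz j sorted_z.
  apply/allP => y yz; have := le_z _ (map_f fst yz).
  by rewrite /label_le /=; lia.
have net_cons v h v' h' r : no_empty_tail ((v, h) :: r) ->
    (v' != [::]) || (h' != [::]) -> @no_empty_tail A ((v', h') :: r).
  move=> net nz s; case: s => [[ev eh er]|y s [_ er]].
    by rewrite ev eh in nz.
  by have := net ((v, h) :: s); rewrite er => /(_ erefl).
case: p net_p ep => [|[v h] p] net_p /= ep.
  rewrite -ep; case: b {le_z} => /=.
    exists [:: ([:: x], [::])] => //; first by move=> [|? [|? ?]].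
  by exists [:: ([::], [:: x])] => //; move=> [|? [|? ?]].
case: b le_z => le_z.
  exists ((x :: v, h) :: p); first exact: net_cons net_p _.
  by split=> //=; rewrite ep.
case: v net_p ep => [|y v] net_p ep.
  exists (([::], x :: h) :: p); first exact: net_cons net_p _.
  by split=> //=; rewrite -ep.
(* An entry labelled j' cannot follow one labelled j, so the vertical strip is empty. *)
have := le_z (j, true); rewrite -ep /= inE eqxx => /(_ isT).
by rewrite /label_le /= ltnn eqxx.
Qed.

(** * Strip conditions on heads *)

(** A head depends on the preceding shape too, so heads cannot be obtained from the entries one by
    one. *)
Definition with_heads (mu : seq nat) (z : seq (nat * bool * seq nat)) :
    seq (nat * bool * (nat * nat)) :=
  zip (map fst z) (heads mu (map snd z)).

Lemma map_snd_pair (A B : Type) (y : A) (s : seq B) :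
  map snd (map (pair y) s) = s.
Proof. by rewrite -map_comp map_id. Qed.

Lemma size_heads mu c : size (heads mu c) = size c.
Proof. exact: size_pairmap. Qed.

Lemma with_heads_cat mu z1 z2 :
  with_heads mu (z1 ++ z2) =
  with_heads mu z1 ++ with_heads (last mu (map snd z1)) z2.
Proof.
by rewrite /with_heads !map_cat /heads pairmap_cat zip_cat // size_pairmap !size_map.
Qed.

Lemma with_heads_pair mu y c :
  with_heads mu (map (pair y) c) = map (pair y) (heads mu c).
Proof. by elim: c mu => //= nu c IHc mu; rewrite -IHc. Qed.

Lemma with_heads_label mu i p :
  all (fun x => i <= x.1.1) (with_heads mu (entries i p)).
Proof.
have: all (fun x => i <= x.1) (map fst (entries i p)).
  by rewrite all_map; apply: entries_label.
have <- : map fst (with_heads mu (entries i p)) = map fst (entries i p).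
  by apply: unzip1_zip; rewrite size_heads !size_map.
by rewrite all_map.
Qed.

Lemma strip_chainP k i mu p la : strip_chain k mu p la <->
  [/\ ribbon_chain k mu (map snd (entries i p)),
      pairwise strip_lt (with_heads mu (entries i p)) &
      last mu (map snd (entries i p)) = la].
Proof.
elim: p i mu => [|[v h] p IHp] i mu /=; first by split=> [->|[]].
rewrite !map_cat !map_snd_pair !with_heads_cat !with_heads_pair !map_snd_pair.
rewrite /ribbon_chain !cat_path !last_cat.
have tr1 : transitive (fun x y : nat * nat => x.1 < y.1) by move=> ? ? ?; apply: ltn_trans.
have tr2 : transitive (fun x y : nat * nat => x.2 < y.2) by move=> ? ? ?; apply: ltn_trans.
have low b hs nu : allrel strip_lt (map (pair (i, b)) hs)
    (with_heads nu (entries i.+1 p)).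
  apply/allrelP => x y /mapP[h' _ ->] /(allP (with_heads_label _ _ _)).
  by rewrite /strip_lt /= => ->.
have mid hs hs' : allrel strip_lt (map (pair (i, true)) hs) (map (pair (i, false)) hs').
  apply/allrelP => x y /mapP[h' _ ->] /mapP[h'' _ ->].
  by rewrite /strip_lt /= eqxx orbT.
have eq_v hs : pairwise strip_lt (map (pair (i, true)) hs) =
    sorted (fun x y : nat * nat => x.2 < y.2) hs.
  rewrite pairwise_map (sorted_pairwise tr2); apply: eq_pairwise => x y.
  by rewrite /= /strip_lt /= ltnn eqxx.
have eq_h hs : pairwise strip_lt (map (pair (i, false)) hs) =
    sorted (fun x y : nat * nat => x.1 < y.1) hs.
  rewrite pairwise_map (sorted_pairwise tr1); apply: eq_pairwise => x y.
  by rewrite /= /strip_lt /= ltnn eqxx.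
rewrite !pairwise_cat allrel_catr mid !low eq_v eq_h /=.
rewrite /vertical_strip /horizontal_strip /ribbon_chain.
split.
  by case=> -[-> ->] [-> ->] /(IHp i.+1)[cp -> ->]; rewrite /ribbon_chain in cp; rewrite cp.
case=> /and3P[-> -> cp] /and3P[-> -> sp] lp; split=> //.
by apply/(IHp i.+1).
Qed.

Lemma ss_weightE S :
  ss_weight S = seq_mset [seq x.1.1 | x <- entries 1 S.2].
Proof.
rewrite /ss_weight; congr seq_mset; case: S => _ p /=.
(* With i - 1 in place of [i.-1], the induction can generalize the first label 1 everywhere at
   once. *)
rewrite (eq_map (g := fun i => nseq (size (nth ([::], [::]) p (i - 1)).1 +
   size (nth ([::], [::]) p (i - 1)).2) i)); last by move=> i; rewrite subn1.
elim: p 1 => [|[v h] p IHp] i //=.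
rewrite subnn /= !map_cat -!map_comp; set f := _ \o _; set g := _ \o _.
have -> : map f v = nseq (size v) i by rewrite /f; elim: v => //= x v ->.
have -> : map g h = nseq (size h) i by rewrite /g; elim: h => //= x h ->.
rewrite catA -nseqD; congr (_ ++ _); rewrite -IHp.
congr flatten; apply/eq_in_map => j; rewrite mem_iota => /andP[ij _].
by rewrite -[j - i]prednK ?subn_gt0 // -subnS.
Qed.

(** * Marks as bit sequences *)

(** Position t holds the mark of the label t + 1, so that marks can be zipped with words and
    chains. *)
Definition marks (n : nat) (M : {fset nat}) : seq bool :=
  [seq i \in M | i <- iota 1 n].

Definition mark_set (b : seq bool) : {fset nat} :=
  [fset i in iota 1 (size b) | nth false b i.-1].

Lemma nth_marks n M i : i < n -> nth false (marks n M) i = (i.+1 \in M).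
Proof. by move=> i_n; rewrite (nth_map 0) ?size_iota // nth_iota. Qed.

Lemma size_marks n M : size (marks n M) = n.
Proof. by rewrite size_map size_iota. Qed.

Lemma mem_mark_set b i :
  (i \in mark_set b) = (0 < i <= size b) && nth false b i.-1.
Proof. by rewrite !inE mem_iota; congr (_ && _); lia. Qed.

Lemma marksK n M : M `<=` [fset i in iota 1 n] -> mark_set (marks n M) = M.
Proof.
move=> sub; apply/fsetP => i; rewrite mem_mark_set size_marks.
have [iM|iM] := boolP (i \in M).
  have := fsubsetP sub _ iM; rewrite !inE mem_iota => i_n.
  by rewrite nth_marks ?prednK ?iM; lia.
by apply/negP => /andP[i_n]; rewrite nth_marks ?prednK ?(negPf iM) //; lia.
Qed.

Lemma mark_setK b : marks (size b) (mark_set b) = b.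
Proof.
apply: (@eq_from_nth _ false); rewrite size_marks // => i i_b.
by rewrite nth_marks // mem_mark_set /= i_b.
Qed.

(** * Coefficients of [F] and [RQ] *)

Definition compatible (n : nat) (D : {fset nat}) (w : seq nat) : Prop :=
  [/\ size w = n, all (leq 1) w, sorted leq w &
    forall t, t \in D -> nth 0 w t.-1 < nth 0 w t].

Definition sorted_word (alpha : monomial) : seq nat := sort leq alpha.

Lemma sorted_word_uniq (w : seq nat) alpha : sorted leq w ->
  (seq_mset w == alpha) = (w == sorted_word alpha).
Proof.
move=> w_sorted; apply/eqP/eqP => [<-|->].
  apply: (sorted_eq leq_trans anti_leq) => //; first exact: sort_sorted leq_total _.
  by rewrite perm_sym perm_sort perm_eq_seq_mset.
by rewrite -[RHS]seq_mset_id; apply/eq_seq_msetP; rewrite perm_sort.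
Qed.

(** [sorted_word alpha] is the only weakly increasing word with content [alpha], so at most one term
    survives. *)
Lemma F_coef n D alpha :
  F n D alpha = ((`[< compatible n D (sorted_word alpha) >])%:R : int)%R.
Proof.
rewrite /F /monomial_sum; case: asboolP => [cw|ncw].
  rewrite -(@fsbig_widen _ _ _ _ [set sorted_word alpha]) ?fsbig_set1.
  - by rewrite sorted_word_uniq ?eqxx //; case: cw.
  - by move=> _ ->.
  - move=> s [[_ _ s_sorted _]] /= /eqP s_neq.
    by rewrite sorted_word_uniq // (negPf s_neq).
apply: fsbig1 => s s_in; rewrite sorted_word_uniq; last by case: s_in.
by case: eqP s_in => // -> /ncw.
Qed.

Lemma RQ_coef k la alpha : RQ k la alpha =
  (\sum_(S \in [set S | semistandard_tableaux k la S /\ ss_weight S = alpha])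
     (1 : int))%R.
Proof.
rewrite /RQ /monomial_sum; set A := (X in (_ = \sum_(_ \in X) _)%R).
rewrite -(@fsbig_widen _ _ _ _ A) => [||S [S_in /= S_A]]; last 2 first.
- by move=> S [].
- by case: eqP => // e; case: S_A.
by apply: eq_fsbigr => S; rewrite inE => -[_ ->]; rewrite eqxx.
Qed.

(** * Standardization *)

(** It suffices to compare neighbours. Equal labels are allowed there exactly at non-descents of the
    marked tableau: by the dichotomy for heads, strictly above means a descent of [T] and strictly
    right means none, and equal marks decide which of the two is asked for. *)
Lemma strip_lt_compatible k T b w : ribbon_chain k T.1 T.2 ->
  size b = size T.2 -> size w = size T.2 ->
  pairwise strip_lt (zip (zip w b) (heads T.1 T.2)) <->
  sorted leq w /\
  forall t, t \in Des_marked (T, mark_set b) -> nth 0 w t.-1 < nth 0 w t.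
Proof.
move=> chain sb sw; rewrite -(sorted_pairwise strip_lt_trans).
have size_z : size (zip (zip w b) (heads T.1 T.2)) = size T.2.
  by rewrite !size_zip size_heads sb sw !minnn.
have step i : i.+1 < size T.2 ->
    strip_lt (nth (0, false, (0, 0)) (zip (zip w b) (heads T.1 T.2)) i)
      (nth (0, false, (0, 0)) (zip (zip w b) (heads T.1 T.2)) i.+1) =
    (nth 0 w i <= nth 0 w i.+1) &&
    ((i.+1 \in Des_marked (T, mark_set b)) ==> (nth 0 w i < nth 0 w i.+1)).
  move=> i_n; rewrite !nth_zip ?size_zip ?size_heads ?sb ?sw ?minnn //.
  rewrite mem_Des_marked (mem_Des _ chain) i_n.
  have := label_head_consecutive chain (i := i.+1) i_n.
  rewrite !mem_mark_set /label_head sb i_n (ltnW i_n) /strip_lt /=.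
  move: (nth _ (heads _ _) i) (nth _ (heads _ _) i.+1) => h h'.
  by case: (nth false b i) (nth false b i.+1) => [] [] /=; case: ifP => /=; lia.
split=> [/(sortedP (0, false, (0, 0))) z_sorted|[/(sortedP 0) w_sorted des]].
  rewrite size_z in z_sorted; split.
    apply/(sortedP 0) => i; rewrite sw => i_n.
    by have := z_sorted _ i_n; rewrite step // => /andP[].
  move=> [|t] tD; first by rewrite mem_Des_marked in tD.
  have t_n : t.+1 < size T.2 by move: tD; rewrite mem_Des_marked => /andP[].
  by have := z_sorted _ t_n; rewrite step // => /andP[_]; rewrite tD.
apply/(sortedP (0, false, (0, 0))) => i; rewrite size_z => i_n.
rewrite step //; rewrite sw in w_sorted; rewrite w_sorted //=.
by apply/implyP => /des.
Qed.

(** Relabels the ribbons by 1, ..., n in the order of the chain and keeps the marks. The lost labels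
    form a weakly increasing word, which the weight determines. *)
Definition standardization (S : seq nat * seq (seq (seq nat) * seq (seq nat))) :
    seq nat * seq (seq nat) * {fset nat} :=
  ((S.1, [seq x.2 | x <- entries 1 S.2]),
   mark_set [seq x.1.2 | x <- entries 1 S.2]).

Lemma zip_components (A B C : Type) (z : seq (A * B * C)) :
  z = zip (zip [seq x.1.1 | x <- z] [seq x.1.2 | x <- z]) [seq x.2 | x <- z].
Proof. by elim: z => // -[[a b] c] z /= <-. Qed.

Lemma standardization_bij k la alpha :
  set_bij [set S | semistandard_tableaux k la S /\ ss_weight S = alpha]
    [set T' | marked_tableaux k la T' /\
       compatible (size T'.1.2) (Des_marked T') (sorted_word alpha)]
    standardization.
Proof.
set w := sorted_word alpha.
have labels S : semistandard_tableaux k la S -> ss_weight S = alpha ->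
    [/\ ribbon_chain k S.1 [seq x.2 | x <- entries 1 S.2],
     [seq x.1.1 | x <- entries 1 S.2] = w,
     last S.1 [seq x.2 | x <- entries 1 S.2] = la &
     compatible (size (entries 1 S.2)) (Des_marked (standardization S)) w].
  case=> [_ /(strip_chainP _ 1)[chain z_sorted last_la] _]; rewrite ss_weightE => wt.
  have := @strip_lt_compatible k (standardization S).1
    [seq x.1.2 | x <- entries 1 S.2] [seq x.1.1 | x <- entries 1 S.2] chain.
  rewrite !size_map => /(_ erefl erefl)[+ _].
  have -> : zip [seq x.1.1 | x <- entries 1 S.2] [seq x.1.2 | x <- entries 1 S.2]
    = map fst (entries 1 S.2) by elim: (entries _ _) => // -[[]] ? ? ? ? /= ->.
  case=> // w_sorted des.
  move/eqP: wt; rewrite sorted_word_uniq // => /eqP ew.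
  split=> //; rewrite -/w in ew; rewrite -ew; split=> //; first by rewrite size_map.
  by rewrite all_map; apply: entries_label.
split.
- move=> S [S_ss wt]; have [chain ew last_la comp] := labels S S_ss wt.
  case: S_ss => core _ _.
  split; last by rewrite /= size_map.
  split=> //=; apply/fsubsetP => i; rewrite mem_mark_set !inE mem_iota !size_map; lia.
- move=> S S'; rewrite !inE => -[S_ss wt] [S'_ss wt'] eS.
  (* Both label words equal [w], so chain and marks determine all entries. *)
  have [_ ew _ _] := labels S S_ss wt; have [_ ew' _ _] := labels S' S'_ss wt'.
  case: S S' S_ss S'_ss wt wt' eS ew ew' => [mu p] [mu' p'] /= [_ _ net] [_ _ net'] _ _.
  case=> -> e2 em ew ew'; congr (_, _); apply: (entries_inj (i := 1)) => //.
  rewrite [LHS]zip_components [RHS]zip_components ew ew' e2; congr (zip (zip _ _) _).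
  rewrite -[LHS]mark_setK -[RHS]mark_setK em; congr marks.
  by move/(congr1 size): e2; rewrite !size_map.
- move=> [[mu c] M] [[[core chain last_la] /= sub_M] [sw w_pos w_sorted des]].
  rewrite -/w /= in sw w_pos w_sorted des core chain last_la.
  pose b := marks (size c) M.
  have sb : size b = size c by rewrite size_marks.
  (* The preimage: the ribbons of the chain receive the letters of [w] and the marks of [M]. *)
  pose z := zip (zip w b) c.
  have z1 : map fst z = zip w b by apply: unzip1_zip; rewrite size_zip sw sb minnn.
  have z2 : map snd z = c by apply: unzip2_zip; rewrite size_zip sw sb minnn.
  have z11 : [seq x.1.1 | x <- z] = w.
    by rewrite (map_comp fst fst) z1; apply: unzip1_zip; rewrite sw sb.
  have z12 : [seq x.1.2 | x <- z] = b.
    by rewrite (map_comp snd fst) z1; apply: unzip2_zip; rewrite sw sb.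
  have z_lt : pairwise strip_lt (zip (zip w b) (heads mu c)).
    apply/(strip_lt_compatible (T := (mu, c)) chain sb sw); split=> // t.
    by rewrite marksK //; apply: des.
  have [||p net ep] := @entries_surj _ 1 z.
  + rewrite z1 -(unzip1_zip (s := zip w b) (t := heads mu c)); last first.
      by rewrite size_zip size_heads sw sb minnn.
    rewrite (sorted_pairwise label_le_trans) pairwise_map.
    apply: sub_pairwise z_lt => -[[i a] h] [[j a'] h'].
    by rewrite /label_le /strip_lt /=; case: a a' => [] []; lia.
  + by rewrite -(all_map (fun x => x.1.1) (leq 1)) z11.
  exists (mu, p); last by rewrite /standardization /= ep z12 z2 marksK.
  split; last first.
    apply/eqP; rewrite ss_weightE /= ep z11 sorted_word_uniq //.
  split=> //; apply/(strip_chainP _ 1); rewrite /with_heads /= ep z1 z2.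
  by split.
Qed.

(** Incompatible marked tableaux contribute 0, so the sum over the image of the bijection extends to
    all of them. *)
Lemma RQ_coef_marked k la alpha : RQ k la alpha =
  (\sum_(T' \in marked_tableaux k la)
     F (size T'.1.2) (Des_marked T') alpha)%R.
Proof.
rewrite RQ_coef -(reindex_fsbig _ _ _ (fun=> (1 : int)%R) (standardization_bij k la alpha)).
set B := (X in (\sum_(_ \in X) _)%R).
rewrite -[RHS](@fsbig_widen _ _ _ _ B) => [||T' [T'_in T'_B]]; last 2 first.
- by move=> T' [].
- by rewrite /= F_coef asboolF // => /(conj T'_in).
by apply: eq_fsbigr => T'; rewrite inE F_coef => -[_ /asboolP ->].
Qed.

(** * Finiteness of the set of standard tableaux *)

Fixpoint bounded_seqs (A : Type) (n : nat) (s : seq A) : seq (seq A) :=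
  if n is n'.+1 then [::] :: [seq x :: t | x <- s, t <- bounded_seqs n' s]
  else [:: [::]].

Lemma mem_bounded_seqs (A : eqType) n (s t : seq A) :
  size t <= n -> {subset t <= s} -> t \in bounded_seqs n s.
Proof.
elim: n t => [|n IHn] [|x t] //=; rewrite ?mem_head // ltnS => t_n sub.
rewrite inE; apply/orP; right; apply: allpairs_f.
  by apply: sub; rewrite mem_head.
by apply: IHn => // y yt; apply: sub; rewrite inE yt orbT.
Qed.

Definition shapes_below (la : seq nat) : seq (seq nat) :=
  bounded_seqs (size la) (iota 0 (sumn la).+1).

Lemma mem_shapes_below la mu : strict_partition mu ->
  diagram mu `<=` diagram la -> mu \in shapes_below la.
Proof.
case/andP=> _ mu0 sub.
have pos i : i < size mu -> 0 < nth 0 mu i.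
  by move=> i_mu; rewrite lt0n; apply: contraNneq mu0 => <-; apply: mem_nth.
have row i : i < size mu -> i < size la /\ nth 0 mu i <= nth 0 la i.
  move=> i_mu; have := pos i i_mu => mu_i.
  (* The last cell of row i + 1 of [mu]; it exists because the parts are positive. *)
  have : (i + nth 0 mu i, i.+1) \in diagram mu by rewrite mem_diagram /=; lia.
  by move/(fsubsetP sub); rewrite mem_diagram /=; lia.
apply: mem_bounded_seqs.
  by rewrite leqNgt; apply/negP => /row[]; rewrite ltnn.
move=> x /(nthP 0)[i /row[_ i_la] <-]; rewrite mem_iota /= add0n ltnS.
apply: leq_trans i_la _; elim: la i {sub row} => [|a la IHla] [|i] //=.
  exact: leq_addr.
by apply: leq_trans (IHla i) _; apply: leq_addl.
Qed.

(** Each step adds [k] cells, at least one, so the number of cells bounds the length; all shapes lie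
    inside the last one. *)
Lemma ribbon_chain_bounds k mu c : 0 < k -> strict_partition mu ->
  ribbon_chain k mu c ->
  [/\ diagram mu `<=` diagram (last mu c),
      #|` diagram mu| + size c <= #|` diagram (last mu c)| &
      {subset mu :: c <= shapes_below (last mu c)}].
Proof.
move=> k_gt0; elim: c mu => [|nu c IHc] mu mu_strict /=.
  move=> _; split; rewrite ?addn0 // => x; rewrite inE => /eqP ->.
  exact: mem_shapes_below.
case/andP=> /asboolP[_ nu_strict sub _ [card_k _]] /(IHc _ nu_strict)[sub' card' mem'].
have sub2 := fsubset_trans sub sub'; split=> //.
  apply: leq_trans card'; rewrite -addSnnS leq_add2r -subn_gt0.
  by rewrite -cardfsDS // card_k.
move=> x; rewrite inE => /predU1P[->|/mem' //]; exact: mem_shapes_below.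
Qed.

Lemma finite_standard_tableaux k la : 0 < k ->
  finite_set (standard_tableaux k la).
Proof.
move=> k_gt0; pose s := shapes_below la.
apply: (sub_finite_set _ (finite_seq
  [seq (mu, c) | mu <- s, c <- bounded_seqs #|` diagram la| s])).
move=> [mu c] [[mu_strict _] chain /= last_la] /=.
have [_ card_c mem_c] := ribbon_chain_bounds k_gt0 mu_strict chain.
rewrite /= last_la in card_c mem_c; apply: allpairs_f.
  by apply: mem_c; rewrite mem_head.
apply: mem_bounded_seqs => [|x xc]; first exact: leq_trans (leq_addl _ _) card_c.
by apply: mem_c; rewrite inE xc orbT.
Qed.

(** Values in any [nmodType] cover both single coefficients and whole series. *)
Lemma sum_marked_tableaux (V : nmodType) k la (f : tableau * {fset nat} -> V) :
  0 < k ->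
  (\sum_(T' \in marked_tableaux k la) f T' =
   \sum_(T \in standard_tableaux k la)
     \sum_(M <- fpowerset [fset i in iota 1 (size T.2)]) f (T, M))%R.
Proof.
move=> k_gt0; have fin := @finite_standard_tableaux k la k_gt0.
rewrite [RHS]fsbig_finite //; set r := fset_set _.
rewrite -(big_allpairs_dep (h := fun (T : tableau) (M : {fset nat}) => (T, M))).
rewrite [RHS]fsbig_seq; last first.
  apply: allpairs_uniq_dep => [|T _|[T M] [T' M'] _ _ [-> ->] //]; exact: fset_uniq.
apply: eq_fsbigl; apply/seteqP.
split=> [[T M] [T_std sub_M]|T' /allpairsPdep[T [M [Tr sub_M ->]]]] /=.
  by apply: allpairs_f_dep; rewrite ?in_fset_set ?inE // fpowersetE.
rewrite fpowersetE in sub_M; split=> //.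
by move: Tr; rewrite in_fset_set // inE.
Qed.

(** * Markings with a given descent set *)

Lemma card_fset_iota n (q : pred nat) :
  #|` [fset i in iota 1 n | q i]| = count q (iota 1 n).
Proof.
rewrite -size_filter; apply/perm_size/uniq_perm; rewrite ?fset_uniq //.
  exact/filter_uniq/iota_uniq.
by move=> i; rewrite !inE mem_filter andbC.
Qed.

Lemma mem_Spike E i :
  (i \in Spike E) = (1 < i) && ((i \in E) (+) (i.-1 \in E)).
Proof.
rewrite !inE; case: (ltnP 1 i) => //= i_gt1; last by rewrite andbF.
case: (boolP (i \in E)) => //= _; case: (boolP (i.-1 \in E)) => i1E.
  rewrite andbT; apply/imfsetP; exists i.-1 => //=; first by rewrite prednK //; lia.
by rewrite andbF.
Qed.

Lemma mem_Peak D i : (i \in Peak D) = [&& i \in D, 1 < i & i.-1 \notin D].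
Proof. by rewrite !inE. Qed.

(** The labels fixed by none of the n - 1 equations: i itself is not in [D], and i - 1 is in [D] or
    absent. *)
Definition free_marks n (D : {fset nat}) : {fset nat} :=
  [fset i in iota 1 n | (i \notin D) && ((i == 1) || (i.-1 \in D))].

(** Read [D] as a 0-1 word on 1, ..., n with a 1 put in front. Free labels are its falls and peaks
    its rises; they alternate, and the word starts with 1 and ends with 0 since n is not in [D]. *)
Lemma card_free_marks n D : 0 < n -> D `<=` [fset i in iota 1 n.-1] ->
  #|` free_marks n D| = #|` Peak D|.+1.
Proof.
move=> n_gt0 /fsubsetP sub_D.
have -> : Peak D =
    [fset i in iota 1 n | [&& i \in D, 1 < i & i.-1 \notin D]].
  apply/fsetP => i; rewrite mem_Peak !inE.
  case: (boolP (i \in D)) => [/sub_D|_]; last by rewrite andbF.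
  by rewrite !inE !mem_iota; lia.
rewrite !card_fset_iota.
have n_D : n \notin D by apply/negP => /sub_D; rewrite !inE mem_iota; lia.
(* For the induction the last letter is arbitrary; a final 1 means one fall less. *)
suff : count (fun i => (i \notin D) && ((i == 1) || (i.-1 \in D))) (iota 1 n) + (n \in D)
   = (count (fun i => [&& i \in D, 1 < i & i.-1 \notin D]) (iota 1 n)).+1.
  by rewrite (negPf n_D) addn0.
elim: n n_gt0 {sub_D n_D} => // -[_ _|n IHn _].
  by rewrite /= andbF; case: (1 \in D).
move/(_ isT) in IHn; have -> : iota 1 n.+2 = iota 1 n.+1 ++ [:: n.+2].
  by have := iotaD 1 n.+1 1; rewrite addn1.
rewrite !count_cat.
move: IHn; set a := count _ _; set b := count _ _.
by rewrite /=; case: (n.+1 \in D); case: (n.+2 \in D) => /=; lia.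
Qed.

(* If i is in D, then [i \in dm M] fixes the mark of i; otherwise it fixes the
   mark of i.+1. So the marks in [free_marks n D] are arbitrary, and only the
   marks of peaks are constrained twice. *)
Lemma sum_marks (V : nmodType) n (D : {fset nat})
    (dm : {fset nat} -> {fset nat}) (f : {fset nat} -> V) :
  0 < n -> D `<=` [fset i in iota 1 n.-1] ->
  (forall M i, (i \in dm M) =
     (0 < i < n) && (if i \in D then i \notin M else i.+1 \in M)) ->
  (\sum_(M <- fpowerset [fset i in iota 1 n]) f (dm M) =
   (\sum_(E <- fpowerset [fset i in iota 1 n.-1] | Peak D `<=` Spike E) f E)
     *+ 2 ^ (#|` Peak D| + 1))%R.
Proof.
move=> n_gt0 sub_D mem_dm.
have inD i : i \in D -> 0 < i < n.
  by move/(fsubsetP sub_D); rewrite !inE mem_iota; lia.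
set N := [fset i in iota 1 n]; set N1 := [fset i in iota 1 n.-1].
have inN i : (i \in N) = (0 < i <= n) by rewrite !inE mem_iota; lia.
have inN1 i : (i \in N1) = (0 < i < n) by rewrite !inE mem_iota; lia.
have dm_N1 M : dm M \in fpowerset N1.
  by rewrite fpowersetE; apply/fsubsetP => i; rewrite mem_dm inN1 => /andP[].
have fiber E : E \in fpowerset N1 ->
    count (fun M => dm M == E) (fpowerset N) =
    if Peak D `<=` Spike E then 2 ^ (#|` Peak D| + 1) else 0.
  rewrite fpowersetE => /fsubsetP sub_E.
  have inE1 i : i \in E -> 0 < i < n by move/sub_E; rewrite inN1.
  case: ifP => [/fsubsetP PS|PS]; last first.
    (* At a peak i of [D], equation i puts i in [M] iff i is not in [E], and equation i - 1 does so
       iff i - 1 is in [E]; together they make i a spike of [E]. *)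
    apply/eqP; rewrite -leqn0 leqNgt -has_count; apply/hasP => -[M _ /eqP dmE].
    move/negP: PS; apply; apply/fsubsetP => i; rewrite mem_Peak mem_Spike.
    case/and3P=> iD i_gt1 i1D; rewrite i_gt1 -dmE !mem_dm iD (negPf i1D).
    have := inD i iD; rewrite prednK; last by lia.
    by case: (i \in M) => /=; lia.
  (* The labels that the equations force to be marked; the solutions are the unions of [C] with a
     subset of [free_marks n D]. *)
  pose C := [fset i in iota 1 n |
    (i \in D) && (i \notin E) || [&& 1 < i, i.-1 \notin D & i.-1 \in E]].
  have memC i : (i \in C) = (0 < i <= n) &&
    ((i \in D) && (i \notin E) || [&& 1 < i, i.-1 \notin D & i.-1 \in E]).
    by rewrite !inE mem_iota; congr (_ && _); lia.
  have memF i : (i \in free_marks n D) =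
    (0 < i <= n) && ((i \notin D) && ((i == 1) || (i.-1 \in D))).
    by rewrite !inE mem_iota; congr (_ && _); lia.
  have disj X i : X `<=` free_marks n D -> i \in X -> i \notin C.
    move=> /fsubsetP sub /sub; rewrite memF memC => /and3P[-> /negPf -> /=].
    by case/orP=> [/eqP ->|->]; rewrite ?andbF.
  rewrite addn1 -(card_free_marks n_gt0 sub_D) -card_fpowerset -size_filter.
  rewrite -(size_map (fun X => X `|` C) (fpowerset _)); apply/perm_size/uniq_perm.
  - exact/filter_uniq/fset_uniq.
  - rewrite map_inj_in_uniq ?fset_uniq // => X Y; rewrite !fpowersetE => sX sY eXY.
    apply/fsetP => i; move/fsetP/(_ i): eXY; rewrite !in_fsetU.
    case: (boolP (i \in C)) => [iC _|_]; last by rewrite !orbF.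
    by rewrite (negPf (contraL (disj X i sX) iC)) (negPf (contraL (disj Y i sY) iC)).
  - move=> M; rewrite mem_filter fpowersetE; apply/andP/mapP => [[/eqP dmE /fsubsetP sM]|].
      exists (M `&` free_marks n D); first by rewrite fpowersetE fsubsetIr.
      apply/fsetP => i; rewrite in_fsetU in_fsetI memF memC.
      have := mem_dm M i; have := mem_dm M i.-1; rewrite dmE.
      have := sM i; have := inD i; have := inD i.-1; rewrite inN.
      case: (posnP i) => [->|i_gt0]; first by case: (0 \in M) => //= _ _ /(_ isT).
      rewrite prednK //.
      case: (i \in M); case: (i \in D); case: (i.-1 \in D); case: (i.-1 \in E);
        case: (i \in E) => /=; lia.
    case=> X; rewrite fpowersetE => sX ->; split; last first.
      apply/fsubsetP => i; rewrite in_fsetU inN => /orP[/(fsubsetP sX)|].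
        by rewrite memF => /andP[].
      by rewrite memC => /andP[].
    apply/eqP/fsetP => i; rewrite mem_dm !in_fsetU.
    have nX : i \in D -> (i \in X) = false.
      by move=> iD; apply/negP => /(fsubsetP sX); rewrite memF iD /= andbF.
    have nX1 : 0 < i -> i \notin D -> (i.+1 \in X) = false.
      move=> i0 iD; apply/negP => /(fsubsetP sX); rewrite memF /= (negPf iD) orbF.
      by rewrite eqSS (gtn_eqF i0) !andbF.
    (* A peak is fixed by both clauses of [C]; it can occur at i if i is in [D] and at i + 1
       otherwise. That it is a spike of [E] makes the clauses agree. *)
    have := PS i; have := PS i.+1; rewrite !mem_Peak !mem_Spike !memC /=.
    have := inE1 i; case: (boolP (0 < i < n)) => /= [i_n _|_]; last first.
      by case: (i \in E) => // /(_ isT).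
    have [-> ->] : 0 < i <= n /\ i < n by lia.
    have /andP[i0 _] := i_n; rewrite ?i0 /= ?ltnS ?i0 /=.
    case: (boolP (i \in D)) => iD; rewrite ?nX ?nX1 //=.
      case: (1 < i); case: (i.-1 \in D); case: (i \in E); case: (i.-1 \in E) => //= _ /(_ isT) //.
    by case: (i.+1 \in D); case: (i \in E); case: (i.+1 \in E) => //= /(_ isT).
(* Group the sets [M] by the value of [dm M]. *)
transitivity (\sum_(M <- fpowerset N) \sum_(E <- fpowerset N1 | dm M == E) f E)%R.
  apply: eq_bigr => M _; rewrite -big_filter.
  rewrite (perm_big [:: dm M]) ?big_seq1 //; apply: uniq_perm => //.
    exact/filter_uniq/fset_uniq.
  move=> E; rewrite mem_filter !inE [E == _]eq_sym.
  by case: eqP => // <- /=; apply: dm_N1.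
rewrite (exchange_big_dep predT) //= -GRing.sumrMnl [RHS]big_mkcond /=.
apply: eq_big_seq => E E_N1.
rewrite big_const_seq GRing.iter_addr_0 fiber //.
by case: ifP.
Qed.

(** When [la] is a k-core its only tableau has n = 0 and a single marking, while the power of 2 in
    the second sum is 2; hence the hypothesis there. *)
Theorem mainTheorem5 (k : nat) (la : seq nat)
    (hk : (1 <= k)%N) (hla : strict_partition la) :
  RQ k la =
    (\sum_(T' \in marked_tableaux k la) F (size T'.1.2) (Des_marked T'))%R /\
  (~ k_core k la ->
   RQ k la =
    (\sum_(T \in standard_tableaux k la)
       G (size T.2) (Peak (Des T)) *+ 2 ^ (#|` Peak (Des T)| + 1)%N)%R).
Proof.
have RQ_marked : RQ k la =
    (\sum_(T' \in marked_tableaux k la) F (size T'.1.2) (Des_marked T'))%R.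
  apply/funext => alpha; rewrite RQ_coef_marked !sum_marked_tableaux //.
  rewrite !fsbig_finite; try exact: finite_standard_tableaux.
  by rewrite fct_sumE; apply: eq_bigr => T _; rewrite fct_sumE.
split=> // not_core; rewrite RQ_marked sum_marked_tableaux //.
apply: eq_fsbigr => T; rewrite inE => -[core chain last_la].
apply: (sum_marks (dm := fun M => Des_marked (T, M))).
(* A tableau without ribbons would have the core [T.1] as its shape. *)
- case: T core last_la {chain} => mu [|nu c] //= core e.
  by case: not_core; rewrite -e.
- exact: subset_Des.
- exact: mem_Des_marked.
Qed.
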